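(* Let $D_{2p}=\langle a,b: a^p=b^2=1, bab=a^{-1}\rangle$ be the dihedral group of order $2p$, where $p$ is a prime. Then \[ \mathcal{B}(D_{2p})=K_2\sqcup pK_{1,3}\sqcup K_{1,p^2-1}\sqcup K_{1,3p(p-1)}. \]
   Context: For a group $G$, let $L(G)$ be the set of all subgroups of $G$. The graph $\mathcal{B}(G)$ is the simple undirected bipartite graph with vertex set the disjoint union $V(\mathcal{B}(G)) = (G\times G) \sqcup L(G)$, in which $(a,b)\in G\times G$ and $H \in L(G)$ are adjacent if and only if $H = \langle a,b\rangle$, and there are no other edges. $K_n$ is the complete graph on $n$ vertices, $K_{1,n}$ is the star on $n+1$ vertices, $\sqcup$ denotes disjoint union of graphs, and $mK_{1,n}$ denotes the disjoint union of $m$ copies of $K_{1,n}$. Equality of graphs means isomorphism. *)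

(* Defs.v *)
From mathcomp Require Import all_boot all_fingroup.

Set Implicit Arguments.
Unset Strict Implicit.
Unset Printing Implicit Defensive.

Record sgraph := SGraph {
  vertex :> finType;
  adj : rel vertex;
  adj_sym : symmetric adj;
  adj_irrefl : irreflexive adj
}.

Definition graph_iso (G H : sgraph) : Prop :=
  exists2 f : G -> H, bijective f & {mono f : x y / adj x y}.

Notation "G ≅ H" := (graph_iso G H) (at level 70, no associativity).

Section CompleteGraph.
Variable n : nat.

Definition complete_adj : rel 'I_n := fun i j => i != j.

Fact complete_adj_sym : symmetric complete_adj.
Proof. by move=> i j; rewrite /complete_adj eq_sym. Qed.

Fact complete_adj_irrefl : irreflexive complete_adj.
Proof. by move=> i; rewrite /complete_adj eqxx. Qed.

Definition complete_graph := SGraph complete_adj_sym complete_adj_irrefl.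
End CompleteGraph.

Section CompleteBipartiteGraph.
Variables m n : nat.

Definition complete_bipartite_adj : rel ('I_m + 'I_n)%type :=
  fun u v => match u, v with
  | inl _, inr _ | inr _, inl _ => true
  | _, _ => false
  end.

Fact complete_bipartite_adj_sym : symmetric complete_bipartite_adj.
Proof. by case=> i [] j. Qed.

Fact complete_bipartite_adj_irrefl : irreflexive complete_bipartite_adj.
Proof. by case. Qed.

Definition complete_bipartite_graph :=
  SGraph complete_bipartite_adj_sym complete_bipartite_adj_irrefl.
End CompleteBipartiteGraph.

Section DisjointUnion.
Variables G H : sgraph.

Definition disjoint_union_adj : rel (G + H)%type :=
  fun u v => match u, v with
  | inl x, inl y => adj x y
  | inr x, inr y => adj x y
  | _, _ => false
  end.

Fact disjoint_union_adj_sym : symmetric disjoint_union_adj.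
Proof. by case=> x [] y //=; rewrite adj_sym. Qed.

Fact disjoint_union_adj_irrefl : irreflexive disjoint_union_adj.
Proof. by case=> x /=; rewrite adj_irrefl. Qed.

Definition disjoint_union :=
  SGraph disjoint_union_adj_sym disjoint_union_adj_irrefl.
End DisjointUnion.

Section Copies.
Variables (m : nat) (G : sgraph).

Definition copies_adj : rel ('I_m * G)%type :=
  fun u v => (u.1 == v.1) && adj u.2 v.2.

Fact copies_adj_sym : symmetric copies_adj.
Proof. by move=> u v; rewrite /copies_adj eq_sym adj_sym. Qed.

Fact copies_adj_irrefl : irreflexive copies_adj.
Proof. by move=> u; rewrite /copies_adj adj_irrefl andbF. Qed.

Definition copies := SGraph copies_adj_sym copies_adj_irrefl.
End Copies.

Notation "''K_' n" := (complete_graph n)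
  (at level 8, n at level 2, format "''K_' n").
Notation "''K_(' m , n )" := (complete_bipartite_graph m n)
  (at level 8, format "''K_(' m ,  n )").
Notation "G ⊔ H" := (disjoint_union G H) (at level 50, left associativity).
Notation "m ⋅ G" := (copies m G) (at level 40, G at level 39).

Section GeneratingGraph.
Local Open Scope group_scope.
Variables (gT : finGroupType) (G : {group gT}).

Definition pair_vertex : finType := {x : gT * gT | x \in setX G G}.
Definition subgroup_vertex : finType := {H : {group gT} | H \in subgroups G}.

Definition generates (x : pair_vertex) (H : subgroup_vertex) : bool :=
  val H == <<[set (val x).1; (val x).2]>> :> {set gT}.

Definition gen_adj : rel (pair_vertex + subgroup_vertex)%type :=
  fun u v => match u, v with
  | inl x, inr H | inr H, inl x => generates x H
  | _, _ => false
  end.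

Fact gen_adj_sym : symmetric gen_adj.
Proof. by case=> x []. Qed.

Fact gen_adj_irrefl : irreflexive gen_adj.
Proof. by case. Qed.

Definition gen_graph := SGraph gen_adj_sym gen_adj_irrefl.
End GeneratingGraph.

Notation "''B' ( G )" := (gen_graph G) (at level 8, format "''B' ( G )").

(* Main.v *)
(** Every pair is adjacent to exactly one subgroup, so B(G) is a disjoint union
    of stars centred at the subgroups H of G, and it is determined by the number
    of pairs generating each H.  Write C for the rotation subgroup of D.  Every
    element outside C is an involution and C is maximal, of prime order; so the
    subgroups of D are 1, the p subgroups of order 2 spanned by the elements
    outside C, C and D (also when p = 2).  A subgroup of prime order q is
    generated by q^2 - 1 pairs; the remaining
    4p^2 - 1 - 3p - (p^2 - 1) = 3p(p - 1) pairs generate D. *)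

Require Import Defs.
From mathcomp Require Import all_boot all_fingroup all_solvable.
From mathcomp Require Import zify.

Set Implicit Arguments.
Unset Strict Implicit.
Unset Printing Implicit Defensive.

(** * Star forests with equal fibre sizes are isomorphic *)

Section StarForest.

(** [L] indexes the stars: [l v] is the star of [v], [z i] the centre of the
    star [i]. *)
Definition star_forest (G : sgraph) (L : eqType) (l : G -> L) (z : L -> G) :=
  cancel z l /\
  forall u v, adj u v =
    [&& l u == l v, u != v & (u == z (l u)) || (v == z (l v))].

Definition fiber (V : finType) (L : eqType) (l : V -> L) (i : L) :=
  [pred v | l v == i].

Variable L : eqType.

Definition fiber_seq (V : finType) (l : V -> L) (z : L -> V) (i : L) :=
  z i :: rem (z i) (enum (fiber l i)).

(** The centre heads both enumerations, so it is mapped to the centre. *)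
Definition transfer (V W : finType) (l : V -> L) (z : L -> V)
    (l' : W -> L) (z' : L -> W) (v : V) : W :=
  nth (z' (l v)) (fiber_seq l' z' (l v)) (index v (fiber_seq l z (l v))).

Lemma perm_fiber_seq (V : finType) (l : V -> L) (z : L -> V) (i : L) :
  cancel z l -> perm_eq (fiber_seq l z i) (enum (fiber l i)).
Proof.
by move=> zK; rewrite perm_sym perm_to_rem // mem_enum inE zK.
Qed.

Lemma mem_fiber_seq (V : finType) (l : V -> L) (z : L -> V) (i : L) :
  cancel z l -> forall v, (v \in fiber_seq l z i) = (l v == i).
Proof. by move=> zK v; rewrite (perm_mem (perm_fiber_seq i zK)) mem_enum. Qed.

Lemma size_fiber_seq (V : finType) (l : V -> L) (z : L -> V) (i : L) :
  cancel z l -> size (fiber_seq l z i) = #|fiber l i|.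
Proof. by move=> zK; rewrite (perm_size (perm_fiber_seq i zK)) cardE. Qed.

Lemma uniq_fiber_seq (V : finType) (l : V -> L) (z : L -> V) (i : L) :
  cancel z l -> uniq (fiber_seq l z i).
Proof. by move=> zK; rewrite (perm_uniq (perm_fiber_seq i zK)) enum_uniq. Qed.

Section Transfer.
Variables (V W : finType) (l : V -> L) (z : L -> V) (l' : W -> L) (z' : L -> W).
Hypotheses (zK : cancel z l) (z'K : cancel z' l').
Hypothesis eq_fiber : forall i, #|fiber l i| = #|fiber l' i|.

(** Equal fibre sizes enter here: a position in the source fibre is a valid position in the target
    fibre, so [nth] in [transfer] returns an actual member of it. *)
Lemma transfer_index_lt v :
  index v (fiber_seq l z (l v)) < size (fiber_seq l' z' (l v)).
Proof.
by rewrite size_fiber_seq // -eq_fiber -(size_fiber_seq _ zK) index_mem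
           mem_fiber_seq.
Qed.

Lemma transfer_label v : l' (transfer l z l' z' v) = l v.
Proof.
by apply/eqP; rewrite -(mem_fiber_seq _ z'K) mem_nth // transfer_index_lt.
Qed.

Lemma transfer_center i : transfer l z l' z' (z i) = z' i.
Proof. by rewrite /transfer zK /= eqxx. Qed.

Lemma transferK : cancel (transfer l z l' z') (transfer l' z' l z).
Proof.
move=> v; rewrite {1}/transfer transfer_label index_uniq ?transfer_index_lt //.
  by rewrite nth_index // mem_fiber_seq.
exact: uniq_fiber_seq.
Qed.

End Transfer.

(** In a star forest adjacency depends only on labels, equality and centres, and [transfer]
    preserves all three. *)
Lemma star_forest_iso (G H : sgraph) (l : G -> L) (z : L -> G)
    (l' : H -> L) (z' : L -> H) :
  star_forest l z -> star_forest l' z' ->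
  (forall i, #|fiber l i| = #|fiber l' i|) -> G ≅ H.
Proof.
move=> [zK adjG] [z'K adjH] eq_fiber.
have fK : cancel (transfer l z l' z') (transfer l' z' l z) by apply: transferK.
have gK : cancel (transfer l' z' l z) (transfer l z l' z') by apply: transferK.
exists (transfer l z l' z') => [|u v]; first by exists (transfer l' z' l z).
rewrite adjG adjH !transfer_label // (can_eq fK).
(* Each centre [z' i] is rewritten as the image of [z i], so that injectivity of the transfer
   settles the tests for being a centre. *)
by rewrite -!(transfer_center l' z' zK) !(can_eq fK).
Qed.

End StarForest.

(** * Unions, copies and single stars as star forests *)

Lemma card_sum_pred (A B : finType) (P : pred (A + B)) :
  #|P| = #|[pred a | P (inl a)]| + #|[pred b | P (inr b)]|.
Proof. by rewrite -!sum1_card big_sumType. Qed.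

Section Union.
Variables (G H : sgraph) (L M : eqType).
Variables (l : G -> L) (z : L -> G) (l' : H -> M) (z' : M -> H).

Definition sum_map (A B A' B' : Type) (f : A -> A') (g : B -> B') (u : A + B) :=
  match u with inl x => inl (f x) | inr y => inr (g y) end.

Lemma star_forest_union :
  star_forest l z -> star_forest l' z' ->
  star_forest (sum_map l l' : G ⊔ H -> _) (sum_map z z').
Proof.
move=> [zK adjG] [z'K adjH]; split; first by case=> i /=; rewrite ?zK ?z'K.
by case=> u [] v /=.
Qed.

Lemma card_fiber_inl i :
  #|fiber (sum_map l l' : G ⊔ H -> _) (inl i)| = #|fiber l i|.
Proof.
by rewrite card_sum_pred -[RHS]addn0; congr (_ + _); apply: eq_card0.
Qed.

Lemma card_fiber_inr j :
  #|fiber (sum_map l l' : G ⊔ H -> _) (inr j)| = #|fiber l' j|.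
Proof.
by rewrite card_sum_pred -[RHS]add0n; congr (_ + _); apply: eq_card0.
Qed.

End Union.

Section CopiesStar.
Variables (m : nat) (G : sgraph) (L : eqType) (l : G -> L) (z : L -> G).

Definition copies_label (u : m ⋅ G) : 'I_m * L := (u.1, l u.2).
Definition copies_center (i : 'I_m * L) : m ⋅ G := (i.1, z i.2).

Lemma star_forest_copies :
  star_forest l z -> star_forest copies_label copies_center.
Proof.
move=> [zK adjG]; split=> [[i j]|[i x] [j y]].
  by rewrite /copies_label /= zK.
rewrite /= /copies_adj /= adjG /copies_label /copies_center /=.
rewrite !xpair_eqE /= !eqxx /=.
by case: eqP => //= _.
Qed.

Lemma card_fiber_copies i : #|fiber copies_label i| = #|fiber l i.2|.
Proof.
rewrite -[RHS]mul1n -(card1 i.1) -cardX; apply: eq_card => -[j x].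
by case: i => i k; rewrite !inE /= xpair_eqE.
Qed.

End CopiesStar.

(** Either end of a single edge can serve as its centre; [ord0] is chosen. *)
Lemma star_forest_K2 : star_forest (fun _ : 'K_2 => tt) (fun _ => ord0).
Proof.
split=> [[]|] //= i j; rewrite /complete_adj.
by case: i j => [[|[|i]] lti] [[|[|j]] ltj].
Qed.

Lemma star_forest_K1 n :
  star_forest (fun _ : 'K_(1, n) => tt) (fun _ => inl ord0).
Proof.
split=> [[]|] //=; case=> i [] j //=; rewrite ?(ord1 i) ?(ord1 j) ?eqxx //=.
by rewrite andbF.
Qed.

Lemma card_fiber_unit (V : finType) i : #|fiber (fun _ : V => tt) i| = #|V|.
Proof. by case: i; apply: eq_card => v; rewrite !inE. Qed.

(** * Counting generating pairs *)

Section GeneratingPairs.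
Local Open Scope group_scope.
Variable gT : finGroupType.
Implicit Types G H : {group gT}.

Definition gen_pairs (A : {set gT}) :=
  [set x : gT * gT | <<[set x.1; x.2]>> == A].

Lemma gen_pairs_sub H : gen_pairs H \subset setX H H.
Proof.
apply/subsetP=> x; rewrite !inE => /eqP <-.
by rewrite !mem_gen // !inE eqxx ?orbT.
Qed.

Lemma card_gen_pairs1 : #|gen_pairs [1 gT]| = 1%N.
Proof.
apply/eqP/cards1P; exists (1, 1); apply/setP=> -[x y].
rewrite !inE xpair_eqE -subG1 gen_subG subUset !sub1set.
by rewrite !inE.
Qed.

(** The only proper subgroup of a group of prime order is trivial, so every pair other than [(1, 1)]
    generates. *)
Lemma card_gen_pairs_prime H :
  prime #|H| -> #|gen_pairs H| = (#|H| ^ 2 - 1)%N.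
Proof.
move=> prH; suff ->: gen_pairs H = setX H H :\ (1, 1).
  rewrite subn1 expnS expn1 -cardsX (cardsD1 (1, 1) (setX H H)).
  by rewrite in_setX group1.
apply/setP=> -[x y]; apply/idP/idP => [Exy|].
  rewrite in_setD1 (subsetP (gen_pairs_sub H)) // andbT.
  apply: contraTneq prH => -[x1 y1]; move: Exy; rewrite inE /= x1 y1 setUid.
  by rewrite (genGid [1 gT]) => /eqP <-; rewrite cards1.
rewrite !inE xpair_eqE /= => /and3P[nt1 Hx Hy].
have sKH : <<[set x; y]>> \subset H.
  by rewrite gen_subG subUset !sub1set Hx Hy.
rewrite eqEsubset sKH /=; apply: contraR nt1 => /(prime_TIg prH).
rewrite (setIidPr sKH) => /eqP; rewrite -subG1 gen_subG subUset !sub1set.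
by rewrite !inE.
Qed.

Variables (G : {group gT}) (L : finType) (sub : L -> {group gT}).
Hypothesis sub_inj : injective sub.
Hypothesis subG : forall i, sub i \subset G.
Hypothesis sub_surj : forall H, H \subset G -> exists i, H = sub i.

(** The sets of generating pairs partition [setX G G], since a pair generates exactly one subgroup.
    This yields the count for the whole group by subtraction. *)
Lemma sum_card_gen_pairs : (\sum_i #|gen_pairs (sub i)| = #|G| ^ 2)%N.
Proof.
rewrite expnS expn1 -cardsX.
have -> : setX G G = \bigcup_i gen_pairs (sub i).
  apply/setP=> x; apply/idP/bigcupP=> [|[i _ /(subsetP (gen_pairs_sub _))]].
    rewrite inE => /andP[Gx Gy].
    have [|i Ei] := sub_surj (H := <<[set x.1; x.2]>>%G).
      by rewrite gen_subG subUset !sub1set Gx Gy.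
    by exists i; rewrite // inE -Ei.
  by rewrite !inE => /andP[/(subsetP (subG i)) -> /(subsetP (subG i)) ->].
rewrite -sum1_card partition_disjoint_bigcup => [|i j neq_ij].
  by apply: eq_bigr => i _; rewrite sum1_card.
apply/pred0P=> x; rewrite !inE; apply: contraNF neq_ij => /andP[/eqP Ei /eqP Ej].
by rewrite -(inj_eq sub_inj) -val_eqE /= -Ei -Ej.
Qed.

End GeneratingPairs.

(** * The subgroups of the dihedral group *)

Section DihedralSubgroups.
Local Open Scope group_scope.

(** This extracts from the presentation all that the subgroup classification needs; [C] is the span
    of the generator [a]. *)
Lemma dihedral_structure (p : nat) (gT : finGroupType) (D : {group gT}) :
    prime p ->
    D \isog Grp (a : b : (a ^+ p, b ^+ 2, b * a * b = a^-1)) ->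
  exists C : {group gT},
    [/\ C \subset D, #|C| = p, #|D| = (2 * p)%N
      & {in D :\: C, forall x, x ^+ 2 = 1}].
Proof.
move=> p_prime isoD; have p_gt1 := prime_gt1 p_prime.
(* D maps onto the library's dihedral group, of order 2p. *)
have leD : 2 * p <= #|D|.
  rewrite mul2n -(card_dihedral p_gt1) leq_homg // isoD.
  have /existsP[[a b]] := isoGrp_hom (Grp_dihedral p_gt1).
  rewrite /= !xpair_eqE => /and4P[/eqP genD /eqP ap /eqP b2 /eqP ab].
  apply/existsP; exists (a, b); rewrite /= !xpair_eqE genD ap b2 !eqxx /=.
  have bV : b^-1 = b by apply/eqP; rewrite eq_invg_mul -(expgS b 1) b2.
  by rewrite -ab conjgE bV mulgA.
have /existsP[[a b]] := isoGrp_hom isoD.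
rewrite /= !xpair_eqE => /and4P[/eqP genD /eqP ap /eqP b2 /eqP bab].
have bV : b^-1 = b by apply/eqP; rewrite eq_invg_mul -(expgS b 1) b2.
have ab : a ^ b = a^-1 by rewrite conjgE bV mulgA.
have nab : <[b]> \subset 'N(<[a]>).
  by rewrite cycle_subG; apply/normP; rewrite -cycleJ ab cycleV.
have defD : <[a]> * <[b]> = D by rewrite -norm_joinEr.
have le_a : #|<[a]>| <= p.
  by rewrite dvdn_leq ?prime_gt0 // -orderE order_dvdn ap.
have le_b : #|<[b]>| <= 2 by rewrite dvdn_leq // -orderE order_dvdn b2.
have le_ab : #|D| <= #|<[a]>| * #|<[b]>|.
  by rewrite mul_cardG defD leq_pmulr // cardG_gt0.
(* The chain [2 * p <= #|D| <= #|<[a]>| * #|<[b]>| <= p * 2] forces equality throughout. *)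
have oa : #|<[a]>| = p by nia.
have oD : #|D| = (2 * p)%N by nia.
exists <[a]>%G; split=> //; first by rewrite -defD mulG_subl.
move=> x; rewrite inE -defD => /andP[nCx /mulsgP[c d Cc]].
move=> /cycleP[n ->] def_x; move: nCx; rewrite {x}def_x.
case/cycleP: Cc => m ->.
(* Only the parity of [n] matters. If it is even, the element lies in [C]; if odd, its square is
   [a ^+ m * (a ^+ m) ^ b = 1]. *)
rewrite -(odd_double_half n) expgD -mul2n expgM b2 expg1n mulg1.
case: (odd n); last by rewrite expg0 mulg1 mem_cycle.
move=> _; have amb : (a ^+ m) ^ b = (a ^+ m)^-1 by rewrite conjXg ab expVgn.
by rewrite /= (expgS _ 1) /= -mulgA -{1}bV -conjgE amb mulgV.
Qed.

Variables (p : nat) (gT : finGroupType) (D C : {group gT}).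
Hypotheses (p_prime : prime p) (sCD : C \subset D).
Hypotheses (oC : #|C| = p) (oD : #|D| = (2 * p)%N).
Hypothesis invol : {in D :\: C, forall x, x ^+ 2 = 1}.

Definition reflection (i : 'I_p) := nth 1 (enum (D :\: C)) i.

(** The index type copies the bracketing of the target graph, one [unit] per star and ['I_p * unit]
    for the [p] copies, so that both star forests carry the same labels. *)
Definition dihedral_subgroup (i : unit + 'I_p * unit + unit + unit) :=
  match i with
  | inl (inl (inl _)) => 1%G
  | inl (inl (inr (k, _))) => <[reflection k]>%G
  | inl (inr _) => C
  | inr _ => D
  end.

Lemma size_reflections : size (enum (D :\: C)) = p.
Proof. by rewrite -cardE cardsD (setIidPr sCD) oC oD mul2n -addnn addnK. Qed.

Lemma mem_reflection i : reflection i \in D :\: C.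
Proof. by rewrite -mem_enum mem_nth // size_reflections. Qed.

Lemma reflection_surj x : x \in D :\: C -> exists i, x = reflection i.
Proof.
move=> Dx; have ltxp : index x (enum (D :\: C)) < p.
  by rewrite -size_reflections index_mem mem_enum.
by exists (Ordinal ltxp); rewrite /reflection nth_index ?mem_enum.
Qed.

Lemma reflection_inj : injective reflection.
Proof.
move=> i j /eqP; rewrite nth_uniq ?enum_uniq ?size_reflections //.
by move/eqP/val_inj.
Qed.

Lemma order_outside x : x \in D :\: C -> #[x] = 2.
Proof.
move=> Dx; apply: nt_prime_order => //; first exact: invol.
by apply: contraTneq Dx => ->; rewrite inE group1.
Qed.

Lemma order_reflection i : #[reflection i] = 2.
Proof. exact/order_outside/mem_reflection. Qed.

Lemma dihedral_subgroup_sub i : dihedral_subgroup i \subset D.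
Proof.
case: i => [[[_|[k _]]|_]|_] //=; first exact: sub1G.
by rewrite cycle_subG; have /setDP[] := mem_reflection k.
Qed.

Lemma setI_cycle_reflection i : C :&: <[reflection i]> = 1.
Proof.
rewrite setIC; apply: prime_TIg; first by rewrite -orderE order_reflection.
by rewrite cycle_subG; have /setDP[] := mem_reflection i.
Qed.

Lemma dihedral_subgroup_inj : injective dihedral_subgroup.
Proof.
have p_gt1 := prime_gt1 p_prime.
move=> i j eqij.
(* The orders of H and C :&: H tell the four kinds of subgroup apart, even when
   p = 2. *)
have := congr1 (fun H : {group gT} => (#|C :&: H|, #|H|)) eqij.
move: eqij; case: i => [[[[]|[k []]]|[]]|[]]; case: j => [[[[]|[m []]]|[]]|[]] //=;
  rewrite ?setI_cycle_reflection ?setIid ?(setIidPl sCD) ?(setIidPr (sub1G C));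
  rewrite ?cards1 -?orderE ?order_reflection ?oC ?oD => eqij; try by case; lia.
(* Two reflection subgroups remain: a group of order 2 has a single nontrivial element, so equal
   spans have equal generators. *)
move=> _; have: reflection k \in <[reflection m]>%G by rewrite -eqij cycle_id.
rewrite /= cycle2g ?order_reflection // !inE => /orP[/eqP rk1|/eqP/reflection_inj-> //].
by have := order_reflection k; rewrite rk1 order1.
Qed.

(** As [C] has prime order, it meets [H] in 1 or in [C]. When [H] is not inside [C], the second case
    leaves room only for [D], and the first bounds the order of [H] by 2. *)
Lemma dihedral_subgroup_surj (H : {group gT}) :
  H \subset D -> exists i, H = dihedral_subgroup i.
Proof.
move=> sHD; have [sHC|nsHC] := boolP (H \subset C).
  have [->|ntH] := eqVneq H 1%G; first by exists (inl (inl (inl tt))).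
  exists (inl (inr tt)); apply/val_inj/eqP; rewrite /= eqEsubset sHC.
  apply: contraR ntH => /prime_TIg; rewrite oC (setIidPr sHC) => TI.
  by apply/eqP/val_inj/TI.
have [x Hx nCx] := subsetPn nsHC.
have DCx : x \in D :\: C by rewrite inE nCx (subsetP sHD).
have [sCH|/prime_TIg TI] := boolP (C \subset H).
  exists (inr tt); apply/val_inj/eqP; rewrite /= eqEcard sHD.
  rewrite oD -(Lagrange sCH) oC mulnC leq_pmul2l ?prime_gt0 //.
  by rewrite ltn_neqAle eq_sym indexg_eq1 nsHC indexg_gt0.
(* With trivial intersection, the product set [C * H] has [#|C| * #|H|] elements, all in [D]. *)
have leH : #|C| * #|H| <= #|D|.
  by rewrite -(TI_cardMg (TI _)) ?oC // subset_leq_card // mul_subG.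
have [k def_x] := reflection_surj DCx.
exists (inl (inl (inr (k, tt)))); apply/val_inj/esym/eqP.
rewrite /= eqEcard -orderE -def_x cycle_subG Hx (order_outside DCx).
by move: leH; rewrite oC oD mulnC leq_pmul2r ?prime_gt0.
Qed.

End DihedralSubgroups.

(** * The generating graph as a star forest *)

Section GeneratingGraphStar.
Local Open Scope group_scope.
Variables (gT : finGroupType) (G : {group gT}) (L : finType).
Variable sub : L -> {group gT}.
Hypothesis sub_inj : injective sub.
Hypothesis subG : forall i, sub i \subset G.
Hypothesis sub_surj : forall H : {group gT}, H \subset G -> exists i, H = sub i.

Let mem_sub i : sub i \in subgroups G.
Proof. by rewrite inE subG. Qed.

Definition generated_subgroup (u : 'B(G)) : {group gT} :=
  match u with
  | inl x => <<[set (val x).1; (val x).2]>>%G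
  | inr H => val H
  end.

(** A vertex is labelled by the index of the subgroup it generates or is; the extra 1 in the fibre
    size is the centre, the subgroup itself. *)
Lemma gen_graph_star :
  exists l : 'B(G) -> L, exists z : L -> 'B(G),
    star_forest l z /\ forall i, #|fiber l i| = #|gen_pairs (sub i)|.+1.
Proof.
have genG u : exists i, generated_subgroup u == sub i.
  have [|i ->] := sub_surj (H := generated_subgroup u); last by exists i.
  case: u => [[[x y] /= Gxy]|[H sHG]] /=; last by rewrite inE in sHG.
  by move: Gxy; rewrite inE gen_subG subUset !sub1set.
pose l u := xchoose (genG u).
have lP u : generated_subgroup u = sub (l u) by apply/eqP/(xchooseP (genG u)).
pose z i : 'B(G) := inr (Sub (sub i) (mem_sub i)).
have lE u i : (l u == i) = (generated_subgroup u == sub i).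
  by rewrite lP (inj_eq sub_inj).
have zE (H : subgroup_vertex G) i : (inr H == z i) = (l (inr H) == i).
  by rewrite lE.
have zK : cancel z l by move=> i; apply/eqP; rewrite -zE.
have genE x H : generates x H = (l (inl x) == l (inr H)).
  by rewrite lE -lP /generates eq_sym.
exists l, z; split=> [|i].
  split=> // -[x|H] [y|K] //=; rewrite ?andbF //.
  - by rewrite zE genE [_ == l (inr K)]eq_sym eqxx andbT eq_sym.
  - by rewrite zE genE eqxx [RHS]andbT eq_sym.
  (* Two subgroup vertices with the same label coincide, which matches the absence of edges between
     them. *)
  - by rewrite lE -lP !(inj_eq inr_inj) val_eqE; case: eqP.
rewrite card_sum_pred -addn1; congr (_ + _)%N; last first.
  rewrite -(card1 (Sub (sub i) (mem_sub i) : subgroup_vertex G)).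
  by apply: eq_card => H; rewrite !inE lE.
(* Pair vertices form a subtype, while [gen_pairs] lives in [gT * gT]; the count is moved along
   [val]. *)
rewrite -(card_imset _ val_inj); apply: eq_card => x; rewrite [RHS]inE.
apply/imsetP/idP => [[y]|Ex]; first by rewrite !inE lE => /eqP Ey ->; rewrite -Ey.
have Gx : x \in setX G G.
  have := subsetP (gen_pairs_sub (sub i)) x; rewrite !inE => /(_ Ex) /andP[].
  by move=> /(subsetP (subG i)) -> /(subsetP (subG i)) ->.
by exists (exist _ x Gx); rewrite // !inE lE -val_eqE /=.
Qed.

End GeneratingGraphStar.

(** * Matching the fibre sizes of both graphs *)

Theorem theorem4p1 (p : nat) (gT : finGroupType) (D : {group gT})
    (p_prime : prime p)
    (D_dihedral :
      (D \isog Grp (a : b : (a ^+ p, b ^+ 2, b * a * b = a^-1)))%g) :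
  'B(D) ≅ 'K_2 ⊔ p ⋅ 'K_(1, 3) ⊔ 'K_(1, p ^ 2 - 1) ⊔ 'K_(1, 3 * p * (p - 1)).
Proof.
have [C [sCD oC oD invol]] := dihedral_structure p_prime D_dihedral.
pose sub := dihedral_subgroup D C (p := p).
have sub_inj : injective sub by apply: dihedral_subgroup_inj.
have subD i : sub i \subset D by apply: dihedral_subgroup_sub.
have sub_surj (H : {group gT}) : H \subset D -> exists i, H = sub i.
  exact: dihedral_subgroup_surj.
have [l [z [starB cardB]]] := gen_graph_star sub_inj subD sub_surj.
have starR := star_forest_union (star_forest_union (star_forest_union
  star_forest_K2 (star_forest_copies p (star_forest_K1 3)))
  (star_forest_K1 (p ^ 2 - 1))) (star_forest_K1 (3 * p * (p - 1))).
apply: (star_forest_iso starB starR) => i; rewrite {}cardB.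
have card_r k : #|gen_pairs (sub (inl (inl (inr (k, tt)))))| = 3.
  by rewrite card_gen_pairs_prime -orderE (order_reflection sCD oC oD invol).
have card_C : #|gen_pairs (sub (inl (inr tt)))| = p ^ 2 - 1.
  by rewrite card_gen_pairs_prime oC.
have sum_unit (F : unit -> nat) : \sum_i F i = F tt.
  by rewrite (big_pred1 tt) // => -[].
have card_D : #|gen_pairs (sub (inr tt))| = 3 * p * (p - 1).
  have := sum_card_gen_pairs sub_inj subD sub_surj.
  rewrite !big_sumType /= !sum_unit card_gen_pairs1 card_C oD.
  rewrite (eq_bigr (fun=> 3)) => [|[k []] _]; last exact: card_r.
  rewrite sum_nat_const card_prod card_ord card_unit.
  (* Positivity of [p] makes the truncated differences [p ^ 2 - 1] and [p - 1] genuine ones. *)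
  have := prime_gt0 p_prime; nia.
case: i => [[[[]|[k []]]|[]]|[]].
- rewrite !card_fiber_inl card_fiber_unit card_ord.
  by rewrite card_gen_pairs1.
- rewrite !card_fiber_inl card_fiber_inr card_fiber_copies card_fiber_unit.
  by rewrite card_sum !card_ord card_r.
- rewrite card_fiber_inl card_fiber_inr card_fiber_unit.
  by rewrite card_sum !card_ord card_C.
- by rewrite card_fiber_inr card_fiber_unit card_sum !card_ord card_D.
Qed.
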